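(* Let $\sigma>0$ and let $X\sim\mathcal{N}(0,\sigma^2)$, so that the i.i.d. sequence $X^{(n)}=(X_1,\dots,X_n)$ of copies of $X$ satisfies $X^{(n)}\sim\mathcal{N}(\mathbf{0},\sigma^2\mathbf{I}_n)$. For every $\epsilon>0$ and all sufficiently large $n$, the volume of the typical set satisfies $$(1-\epsilon)\big(2^{-\epsilon} \sqrt{2\pi e}\, \sigma \big)^n \leq \mathrm{Vol}\big(A_\epsilon^{(n)}(X)\big) \leq \big(2^\epsilon \sqrt{2\pi e}\, \sigma \big)^n .$$
   Context: $\log$ denotes the base-2 logarithm and $f$ is the density of $X$. The differential entropy of $X$ is $h(X)=-\int_{\mathbb{R}} f(x)\log f(x)\,dx$, which equals $\log(\sqrt{2\pi e}\,\sigma)$. The typical set is $$A_\epsilon^{(n)}(X)=\Big\{(x_1,\dots,x_n)\in\mathbb{R}^n:\Big|-\frac1n\log f(x_1,\dots,x_n)-h(X)\Big|\le \epsilon\Big\},$$ where $f(x_1,\dots,x_n)=\prod_{i=1}^n f(x_i)$. $\mathrm{Vol}(A)=\int_A dx_1\cdots dx_n$ is Lebesgue measure. *)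

(* Defs.v *)
From HB Require Import structures.
From mathcomp Require Import all_boot all_order all_algebra.
From mathcomp Require Import all_classical all_reals all_analysis.

Set Implicit Arguments.
Unset Strict Implicit.
Unset Printing Implicit Defensive.
Import Order.TTheory GRing.Theory Num.Theory.
Import numFieldNormedType.Exports.

Local Open Scope classical_set_scope.
Local Open Scope ring_scope.

Section volume.
Context {R : realType}.
Local Open Scope ereal_scope.
Local Notation mR := (measurableTypeR R).
Local Notation mu := (@lebesgue_measure R).

Definition consU n (p : mR * n.-tuple mR) : n.+1.-tuple mR :=
  [the n.+1.-tuple mR of p.1 :: p.2].

(* Lebesgue measure on the Borel sets of R^n, R^n being the type of n-tuples:
   the n-fold product of the Lebesgue measure on R (a Dirac mass on the
   one-point space R^0), transported along R * R^n -> R^(n+1).  The instances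
   and [Vol_box] below show that it is the measure giving boxes the product of
   the lengths of their sides. *)
Fixpoint Vol (n : nat) : set (n.-tuple mR) -> \bar R :=
  if n is m.+1 then pushforward (mu \x @Vol m) (@consU m)
  else \d_([tuple] : 0.-tuple mR).

Let measurable_consU n : measurable_fun setT (@consU n).
Proof. exact: measurable_cons. Qed.

Let unconsU n (t : n.+1.-tuple mR) : mR * n.-tuple mR :=
  (tnth t ord0, [tuple of behead t]).

Let measurable_unconsU n : measurable_fun setT (@unconsU n).
Proof.
apply: measurable_fun_pair; first exact: measurable_tnth.
exact: measurable_behead.
Qed.

Let consUK n : cancel (@consU n) (@unconsU n).
Proof.
move=> [x t]; rewrite /unconsU /consU /=; congr pair.
by apply: val_inj.
Qed.

Section step.
Context n (m : {sigma_finite_measure set (n.-tuple mR) -> \bar R}).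

Definition Vol_step := pushforward (mu \x m) (@consU n).

Let stepE A : Vol_step A = (mu \x m) (@consU n @^-1` A). Proof. by []. Qed.

Let measurable_preU A : measurable A -> measurable (@consU n @^-1` A).
Proof. by move=> mA; rewrite -[X in measurable X]setTI; exact: measurable_consU. Qed.

Let step0 : Vol_step set0 = 0.
Proof. by rewrite stepE preimage_set0 measure0. Qed.

Let step_ge0 A : 0 <= Vol_step A.
Proof. by apply: integral_ge0 => x _ /=. Qed.

Let step_sigma_additive : semi_sigma_additive Vol_step.
Proof.
move=> F mF tF mUF; rewrite stepE preimage_bigcup.
apply: (@measure_semi_sigma_additive _ _ _ (mu \x m)
  (fun k => @consU n @^-1` F k)).
- by move=> k; exact: measurable_preU.
- apply/trivIsetP => /= i j _ _ ij; rewrite -preimage_setI.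
  by move/trivIsetP : tF => /(_ _ _ _ _ ij) ->//; rewrite preimage_set0.
- by rewrite -preimage_bigcup; exact: measurable_preU.
Qed.

HB.instance Definition _ := isMeasure.Build _ _ _ Vol_step
  step0 step_ge0 step_sigma_additive.

Let step_sigma_finite : sigma_finite setT Vol_step.
Proof.
have /sigma_finiteP[F [TF ndF Foo]] := sigma_finiteT mu.
have /sigma_finiteP[G [TG ndG Goo]] := sigma_finiteT m.
have FG k : @consU n @^-1` (@unconsU n @^-1` (F k `*` G k)) = F k `*` G k.
  rewrite -comp_preimage (_ : _ \o _ = idfun) ?preimage_id//.
  by apply/funext => x; exact: consUK.
exists (fun k => @unconsU n @^-1` (F k `*` G k)).
  rewrite -preimage_bigcup; apply/esym; rewrite -(preimage_setT (@unconsU n)).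
  congr (_ @^-1` _); apply/seteqP; split=> // -[x t] _.
  have [i _ Fx] : (\bigcup_k F k) x by rewrite -TF.
  have [j _ Gt] : (\bigcup_k G k) t by rewrite -TG.
  exists (maxn i j) => //; split.
    by move: x Fx; exact/subsetPset/ndF/leq_maxl.
  by move: t Gt; exact/subsetPset/ndG/leq_maxr.
move=> k; have [mF Fk] := Foo k; have [mG Gk] := Goo k; split.
  rewrite -[X in measurable X]setTI; apply: measurable_unconsU => //.
  exact: measurableX.
by rewrite stepE FG product_measure1E// lte_mul_pinfty// ge0_fin_numE.
Qed.

HB.instance Definition _ := Measure_isSigmaFinite.Build _ _ _ Vol_step
  step_sigma_finite.

Lemma Vol_stepP :
  exists m' : {sigma_finite_measure set (n.+1.-tuple mR) -> \bar R},
    pushforward (mu \x m) (@consU n) = m'.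
Proof. by exists Vol_step. Qed.

End step.

Let VolP n :
  exists m : {sigma_finite_measure set (n.-tuple mR) -> \bar R}, @Vol n = m.
Proof.
elim: n => [|n [m mE]]; first by exists \d_([tuple] : 0.-tuple mR).
by rewrite /= mE; exact: Vol_stepP.
Qed.

Let Vol0 n : @Vol n set0 = 0.
Proof. by have [m ->] := VolP n; rewrite measure0. Qed.

Let Vol_ge0 n A : 0 <= @Vol n A.
Proof. by have [m ->] := VolP n; exact: measure_ge0. Qed.

Let Vol_sigma_additive n : semi_sigma_additive (@Vol n).
Proof. by have [m ->] := VolP n; exact: measure_semi_sigma_additive. Qed.

HB.instance Definition _ n := isMeasure.Build _ _ _ (@Vol n)
  (@Vol0 n) (@Vol_ge0 n) (@Vol_sigma_additive n).

Let Vol_sigma_finite n : sigma_finite setT (@Vol n).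
Proof. by have [m ->] := VolP n; exact: sigma_finiteT. Qed.

HB.instance Definition _ n := Measure_isSigmaFinite.Build _ _ _ (@Vol n)
  (@Vol_sigma_finite n).

Lemma Vol_box n (A : 'I_n -> set mR) : (forall i, measurable (A i)) ->
  Vol [set t : n.-tuple mR | forall i, A i (tnth t i)] = \prod_(i < n) mu (A i).
Proof.
elim: n A => [|n ih] A mA.
  by rewrite big_ord0 /= diracE mem_set//= => -[].
rewrite big_ord_recl -ih// -product_measure1E//; last first.
  rewrite (_ : mkset _ = \bigcap_(i in [set: 'I_n])
      ((fun t : n.-tuple mR => tnth t i) @^-1` A (lift ord0 i))).
    apply: fin_bigcap_measurable => // i _.
    by rewrite -[X in measurable X]setTI; exact: measurable_tnth.
  by apply/seteqP; split=> [t At i _|t At i]; [exact: At|exact: (At i)].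
congr (product_measure1 _ _ _); apply/seteqP; split=> [[x t] /= At|].
  by split=> [|i]; [exact: (At ord0)|move: (At (lift ord0 i)); rewrite tnthS].
move=> [x t] [/= Ax At] i; have [->//|] := eqVneq i ord0.
by case: (unliftP ord0 i) => [j ->|->] // _; rewrite tnthS.
Qed.

End volume.

Section typical_set.
Context {R : realType}.
Local Open Scope ereal_scope.

Definition is_density d (T : measurableType d) (P : probability T R)
    (X : {RV P >-> R}) (f : R -> R) :=
  [/\ measurable_fun setT f, (forall x, (0 <= f x)%R) &
      forall A : set R, measurable A ->
        distribution P X A = \int[lebesgue_measure]_(x in A) (f x)%:E].

(* Base-2 logarithm with log 0 = -oo; the products f * log f below then follow
   the convention 0 * log 0 = 0, since 0 * -oo = 0 in \bar R. *)
Definition log2 (x : R) : \bar R := lne x%:E * ((ln 2)^-1)%:E.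

Definition diff_entropy (f : R -> R) : \bar R :=
  - \int[lebesgue_measure]_x ((f x)%:E * log2 (f x)).

Definition joint_density (f : R -> R) n (x : n.-tuple R) : R :=
  (\prod_(i < n) f (tnth x i))%R.

Definition typical_set (f : R -> R) (eps : R) n : set (n.-tuple R) :=
  [set x | `| - ((n%:R^-1)%:E * log2 (joint_density f x)) - diff_entropy f |
           <= eps%:E].

End typical_set.

Arguments typical_set {R} f eps n.
Arguments Vol {R n} A : rename.

(* Main.v *)
Require Import Defs.
From HB Require Import structures.
From mathcomp Require Import all_boot all_order all_algebra.
From mathcomp Require Import all_classical all_reals all_analysis.
From mathcomp Require Import measurable_realfun ring lra.
Import Order.TTheory GRing.Theory Num.Theory.
Import numFieldNormedType.Exports.
Local Open Scope classical_set_scope.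
Local Open Scope ring_scope.

(** All estimates come from one bound on the power moments of the normal density:
    [\int f^(1+s) <= exp (s^2 - s H)] for [|s| <= 1/2], where
    [H = ln (sqrt (2 pi e) sigma)] is the entropy in nats; the integral is
    computed by recognising [f^(1+s)] as a multiple of another normal density.
    It depends on [f] only up to null sets, so it holds for every density of X.
    - Since [f + s f ln f <= f^(1+s)], letting [s] tend to 0 from both sides
      gives [\int f ln f = - H].
    - With [delta = eps ln 2], the typical set is
      [{exp (-n (H + delta)) <= J <= exp (-n (H - delta))}] for the joint
      density [J]; as [J] integrates to 1, the lower bound on [J] gives the
      upper bound on the volume.
    - Chernoff: for small [s > 0] the mass of [J] outside the typical set is at
      most [e^(-ns(H+delta)) \int J^(1-s) + e^(ns(H-delta)) \int J^(1+s)], that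
      is at most [2 exp (n (s^2 - s delta))], which tends to 0. The upper bound
      on [J] in the typical set then gives the lower bound on the volume. *)

(** * Product functions on R^n and their integrals *)

Lemma joint_density_ge0 (R : realType) (f : R -> R) n (t : n.-tuple R) :
  (forall x, 0 <= f x) -> 0 <= joint_density f t.
Proof. by move=> f0; apply: prodr_ge0. Qed.

Lemma measurable_joint_density (R : realType) (f : R -> R) n :
  measurable_fun setT f ->
  measurable_fun setT (fun t : n.-tuple (measurableTypeR R) => joint_density f t).
Proof.
move=> mf; rewrite /joint_density; apply: measurable_prod => i _.
by apply: (measurableT_comp mf); exact: measurable_tnth.
Qed.

Lemma joint_density_consU (R : realType) (f : R -> R) n x (t : n.-tuple R) :
  joint_density f (consU (x, t)) = f x * joint_density f t.
Proof.
rewrite /joint_density big_ord_recl /=; congr (_ * _).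
by apply: eq_bigr => i _; rewrite tnthS.
Qed.

(** Induction on [n]: [Vol] is by definition the pushforward along [consU], and Tonelli splits off
    the first coordinate. The value [c] is arbitrary so that the result also serves for the powers
    of a density. *)
Lemma integral_joint_density (R : realType) (f : R -> R) (c : R) n :
  measurable_fun setT f -> (forall x, 0 <= f x) ->
  (\int[lebesgue_measure]_x (f x)%:E)%E = c%:E ->
  (\int[@Vol R n]_t (joint_density f t)%:E)%E = (c ^+ n)%:E.
Proof.
move=> mf f0 fc; elim: n => [|n ih].
  rewrite [LHS]integral_dirac//=; last first.
    by apply/measurable_EFinP; exact: measurable_joint_density.
  by rewrite diracT mul1e /joint_density big_ord0 expr0.
have mc : measurable_fun setT (@consU R n) by exact: measurable_cons.
pose m1 : {measure set _ -> \bar R} := (@lebesgue_measure R \x @Vol R n)%E.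
transitivity (\int[pushforward m1 (@consU R n)]_t (joint_density f t)%:E)%E.
  by [].
rewrite (ge0_integral_pushforward mc m1 measurableT); last 2 first.
- by apply/measurable_EFinP; exact: measurable_joint_density.
- by move=> t _; rewrite lee_fin joint_density_ge0.
rewrite preimage_setT.
rewrite (@fubini_tonelli1 _ _ _ _ _ lebesgue_measure (@Vol R n)); last 2 first.
- apply/measurable_EFinP; apply: (measurableT_comp _ mc).
  exact: measurable_joint_density.
- by move=> t; rewrite lee_fin joint_density_ge0.
rewrite /fubini_F; under eq_integral => x _.
  under eq_integral => t _ do rewrite /= joint_density_consU EFinM.
  rewrite ge0_integralZl//=; last 3 first.
  - by apply/measurable_EFinP; exact: measurable_joint_density.
  - by move=> t _; rewrite lee_fin joint_density_ge0.
  - by rewrite lee_fin.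
  rewrite ih; over.
rewrite ge0_integralZr//=; last 3 first.
- exact/measurable_EFinP.
- by move=> x _; rewrite lee_fin.
- have c0 : 0 <= c by rewrite -lee_fin -fc integral_ge0// => x _; rewrite lee_fin.
  by rewrite lee_fin exprn_ge0.
by rewrite fc exprS EFinM.
Qed.

Lemma joint_density_powR (R : realType) (f : R -> R) p n (t : n.-tuple R) :
  (forall x, 0 <= f x) ->
  joint_density (fun x => f x `^ p) t = joint_density f t `^ p.
Proof.
(* Nonnegativity of the partial products is carried along because [powRM] requires it. *)
move=> f0; suff [] : 0 <= joint_density f t /\
  joint_density (fun x => f x `^ p) t = joint_density f t `^ p by [].
apply: (big_ind2 (fun x y : R => 0 <= x /\ y = x `^ p)) => //.
- by rewrite powR1.
- by move=> x1 x2 y1 y2 [x10 ->] [y10 ->]; rewrite mulr_ge0// powRM.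
Qed.

(** * Power moments of the normal density *)

Definition power_moment_bound {R : realType} (f : R -> R) (H : R) :=
  forall s : R, `|s| <= 2^-1 ->
    (\int[lebesgue_measure]_x (f x `^ (1 + s))%:E
      <= (expR (s ^+ 2 - s * H))%:E)%E.

Lemma expR_half (R : realType) : expR (2^-1 : R) = Num.sqrt (expR 1).
Proof.
rewrite -[LHS]ger0_norm ?expR_ge0// -sqrtr_sqr -expRM_natl.
by congr (Num.sqrt (expR _)); field.
Qed.

Lemma normal_peakE (R : realType) (sigma : R) : 0 < sigma ->
  normal_peak sigma =
  expR (2^-1 - ln (Num.sqrt (2 * pi * expR 1) * sigma)).
Proof.
move=> s0; have pi0 := pi_gt0 R.
rewrite expRB lnK ?posrE ?mulr_gt0 ?sqrtr_gt0 ?mulr_gt0 ?expR_gt0//.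
rewrite /normal_peak -mulr_natr -mulrA (mulrC pi) (sqrtrM (2 * pi)) ?sqr_ge0//.
rewrite sqrtr_sqr gtr0_norm// (sqrtrM (expR 1)) ?mulr_ge0 ?ltW// expR_half.
have e0 : Num.sqrt (expR 1) != 0 :> R by rewrite gt_eqF// sqrtr_gt0 expR_gt0.
have p0 : Num.sqrt (2 * pi) != 0 :> R by rewrite gt_eqF// sqrtr_gt0 mulr_gt0.
by field; rewrite e0 p0 gt_eqF.
Qed.

Lemma normal_peakD (R : realType) (sigma s : R) : 0 < sigma -> 0 < 1 + s ->
  normal_peak (sigma / Num.sqrt (1 + s)) = normal_peak sigma * Num.sqrt (1 + s).
Proof.
move=> sig0 s0; have pi0 := pi_gt0 R.
rewrite /normal_peak exprMn exprVn sqr_sqrtr ?(ltW s0)//.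
have -> : sigma ^+ 2 / (1 + s) * pi *+ 2 = (sigma ^+ 2 * pi *+ 2) / (1 + s).
  by field; rewrite gt_eqF.
have v0 : 0 <= sigma ^+ 2 * pi *+ 2.
  by rewrite mulrn_wge0// mulr_ge0 ?sqr_ge0 ?ltW.
rewrite sqrtrM//.
by rewrite sqrtrV ?(ltW s0)// invfM invrK.
Qed.

(** Multiplying the Gaussian exponent by [1 + s] divides the variance by [1 + s]; the constant
    factor corrects the peak. *)
Lemma normal_pdf_powR (R : realType) (sigma s x : R) : 0 < sigma -> 0 < 1 + s ->
  normal_pdf 0 sigma x `^ (1 + s) =
  normal_peak sigma `^ s / Num.sqrt (1 + s) *
    normal_pdf 0 (sigma / Num.sqrt (1 + s)) x.
Proof.
move=> sig0 s0; have q0 : 0 < Num.sqrt (1 + s) by rewrite sqrtr_gt0.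
have peak0 : 0 < normal_peak sigma by rewrite normal_peak_gt0 ?gt_eqF.
rewrite !normal_pdfE ?gt_eqF ?divr_gt0// normal_peakD//.
rewrite powRM ?expR_ge0 ?(ltW peak0)// /normal_fun -expRM.
rewrite powRD ?gt_eqF ?implybT// powRr1 ?(ltW peak0)//.
rewrite exprMn exprVn sqr_sqrtr ?(ltW s0)//.
have -> : - (x - 0) ^+ 2 / (sigma ^+ 2 *+ 2) * (1 + s) =
   - (x - 0) ^+ 2 / (sigma ^+ 2 / (1 + s) *+ 2).
  by field; rewrite !gt_eqF.
by field; rewrite gt_eqF.
Qed.

(** The moment equals [exp (s (1/2 - H)) / sqrt (1 + s)], so the claim reduces to
    [exp (s - 2 s^2) <= 1 + s]. This follows from [exp (s / (1 + s)) <= 1 + s], since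
    [s - 2 s^2 <= s / (1 + s)] amounts to [0 <= s^2 (1 + 2 s)]. *)
Lemma normal_pdf_power_moment_bound (R : realType) (sigma : R) : 0 < sigma ->
  power_moment_bound (normal_pdf 0 sigma)
    (ln (Num.sqrt (2 * pi * expR 1) * sigma)).
Proof.
move=> sig0 s sh; have s0 : 2^-1 <= 1 + s.
  by move: sh; rewrite ler_norml => /andP[+ _]; lra.
have s0' : 0 < 1 + s by lra.
under eq_integral do rewrite normal_pdf_powR// EFinM.
rewrite ge0_integralZl//=; last 3 first.
- by apply/measurable_EFinP; exact: measurable_normal_pdf.
- by move=> x _; rewrite lee_fin normal_pdf_ge0.
- by rewrite lee_fin divr_ge0 ?powR_ge0 ?sqrtr_ge0.
rewrite integral_normal_pdf mule1 lee_fin normal_peakE// -expRM.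
rewrite ler_pdivrMr ?sqrtr_gt0//; set H := ln _.
have -> : (2^-1 - H) * s = (s ^+ 2 - s * H) + (s / 2 - s ^+ 2) by field.
rewrite expRD ler_pM2l ?expR_gt0// -[leLHS]ger0_norm ?expR_ge0// -sqrtr_sqr.
rewrite ler_wsqrtr// -expRM_natl.
have : 1 - s / (1 + s) <= expR (- (s / (1 + s))) by apply: expR_ge1Dx.
have -> : 1 - s / (1 + s) = (1 + s)^-1 by field; rewrite gt_eqF.
rewrite expRN lef_pV2 ?posrE ?expR_gt0//; apply: le_trans.
rewrite ler_expR ler_pdivlMr// -subr_ge0.
have -> : s - 2 * (s / 2 - s ^+ 2) * (1 + s) = s ^+ 2 * (2 * (1 + s) - 1).
  by field.
by rewrite mulr_ge0 ?sqr_ge0//; lra.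
Qed.

(** * Passage to an arbitrary density of the variable *)

Lemma density_ae_normal_pdf (R : realType) d (T : measurableType d)
    (P : probability T R) (X : {RV P >-> R}) (f : R -> R) (m sigma : R) :
  (forall A : set R, measurable A ->
     distribution P X A = normal_prob m sigma A) ->
  is_density X f ->
  ae_eq lebesgue_measure setT (EFin \o normal_pdf m sigma) (EFin \o f).
Proof.
move=> XN [mf f0 fX]; apply: integral_ae_eq => //.
- exact: integrable_normal_pdf.
- exact/measurable_EFinP.
- by move=> E _ mE; rewrite -(fX E mE) XN.
Qed.

Lemma ae_eq_power_moment_bound (R : realType) (f g : R -> R) (H : R) :
  measurable_fun setT f -> measurable_fun setT g ->
  ae_eq lebesgue_measure setT (EFin \o f) (EFin \o g) ->
  power_moment_bound f H -> power_moment_bound g H.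
Proof.
move=> mf mg fg fH s sh; apply: le_trans (fH s sh).
rewrite le_eqVlt; apply/orP; left; apply/eqP.
apply: ae_eq_integral => //.
- apply/measurable_EFinP; exact: (measurableT_comp (measurable_powR (1 + s)) mg).
- apply/measurable_EFinP; exact: (measurableT_comp (measurable_powR (1 + s)) mf).
- by apply: filterS fg => x /(_ I) [] fgx _; rewrite /= fgx.
Qed.

(* If [D := I + H] is nonzero, the hypothesis fails at [s = t D] for the explicit
   small [t] below. *)
Lemma exp_bound_slope (R : realType) (I H : R) :
  (forall s : R, `|s| <= 2^-1 -> 1 + s * I <= expR (s ^+ 2 - s * H)) -> I = - H.
Proof.
move=> IH; apply/eqP; rewrite -addr_eq0; apply/eqP.
set D := I + H; have [//|D0] := eqVneq D 0; exfalso.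
pose a := 1 + `|D|; pose b := 1 + `|H|; pose c := 1 + `|I|.
have a1 : 1 <= a by rewrite lerDl. have b1 : 1 <= b by rewrite lerDl.
have c1 : 1 <= c by rewrite lerDl.
have ab1 : 1 <= a * b by rewrite -[leLHS]mulr1 ler_pM.
have ac1 : 1 <= a * c by rewrite -[leLHS]mulr1 ler_pM.
have bc1 : 1 <= b * c by rewrite -[leLHS]mulr1 ler_pM.
have abc1 : 1 <= a * b * c by rewrite -[leLHS]mulr1 ler_pM.
(* This size makes [t] and the absolute values of [t D], [t D H], [t I H] and [t D I] at most
   1/4. *)
pose t := (4 * (a * b * c))^-1.
have t0 : 0 < t by rewrite invr_gt0; nra.
have tM : t * (a * b * c) = 4^-1 by rewrite /t; field; nra.
have tle x : x <= a * b * c -> t * x <= 4^-1 by move=> xM; rewrite -tM ler_pM2l.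
have aabc : a <= a * b * c by rewrite -mulrA ler_peMr//; nra.
have ababc : a * b <= a * b * c by rewrite ler_peMr//; nra.
have bcabc : b * c <= a * b * c by rewrite -mulrA ler_peMl//; nra.
have acabc : a * c <= a * b * c by rewrite mulrAC ler_peMr//; nra.
have tD : `|t * D| <= 4^-1.
  rewrite normrM (gtr0_norm t0) tle// (le_trans _ aabc)//.
  by rewrite /a lerDr.
have tDH : `|t * D * H| <= 4^-1.
  rewrite -mulrA normrM (gtr0_norm t0) tle// (le_trans _ ababc)// normrM ler_pM//.
    by rewrite /a lerDr.
  by rewrite /b lerDr.
have tIH : `|t * (I * H)| <= 4^-1.
  rewrite normrM (gtr0_norm t0) tle// (le_trans _ bcabc)// mulrC normrM ler_pM//.
    by rewrite /c lerDr.
  by rewrite /b lerDr.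
have tDI : `|t * (D * I)| <= 4^-1.
  rewrite normrM (gtr0_norm t0) tle// (le_trans _ acabc)// normrM ler_pM//.
    by rewrite /a lerDr.
  by rewrite /c lerDr.
have t4 : t <= 4^-1 by rewrite -[leLHS]mulr1 tle.
have /IH : `|t * D| <= 2^-1 by rewrite (le_trans tD)// lef_pV2 ?posrE// ler_nat.
set y := _ - _ => Iy.
have y1 : y < 1.
  move: tD tDH; rewrite !ler_norml => /andP[? ?] /andP[? ?].
  by rewrite /y; nra.
have ye : 1 - y <= expR (- y) by exact: expR_ge1Dx.
(* Multiplying by [1 - y <= exp (- y)] removes the exponential. What remains factors as [t D^2]
   times a bracket that the bounds above make negative. *)
have : (1 + t * D * I) * (1 - y) <= 1.
  apply: (@le_trans _ _ (expR y * (1 - y))); first by rewrite ler_pM2r ?subr_gt0.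
  apply: (@le_trans _ _ (expR y * expR (- y))); first by rewrite ler_pM2l ?expR_gt0.
  by rewrite -expRD subrr expR0.
have D2 : 0 < D ^+ 2 by rewrite exprn_even_gt0.
rewrite -subr_ge0.
have -> : 1 - (1 + t * D * I) * (1 - y) =
    t * D ^+ 2 * (t - t * (I * H) + t * (t * (D * I)) - 1).
  by rewrite /y (_ : I = D - H); [ring|rewrite /D; ring].
rewrite pmulr_rge0; last exact: mulr_gt0.
move: tIH tDI; rewrite !ler_norml => /andP[? ?] /andP[? ?].
by nra.
Qed.

(** * Entropy from the power moments *)

Section concentration.
Context (R : realType) (f : R -> R) (H : R).
Context (mf : measurable_fun setT f) (f0 : forall x, 0 <= f x).
Context (f1 : (\int[lebesgue_measure]_x (f x)%:E = 1)%E).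
Context (fH : power_moment_bound f H).
Local Notation mu := (@lebesgue_measure R).

Lemma integrable_density_powR (s : R) : `|s| <= 2^-1 ->
  mu.-integrable setT (fun x => (f x `^ (1 + s))%:E).
Proof.
move=> sh; apply/integrableP; split.
  by apply/measurable_EFinP; exact: (measurableT_comp (measurable_powR (1 + s)) mf).
under eq_integral do rewrite gee0_abs ?lee_fin ?powR_ge0//.
by rewrite (le_lt_trans (fH _ sh)) ?ltry.
Qed.

(** Where [f x > 0], the left side is the tangent at [s = 0] of a convex function of [s]. Where
    [f x = 0], both sides vanish, the hypothesis excluding [0^0 = 1]. *)
Lemma density_powR_tangent (s x : R) : 1 + s != 0 ->
  f x + s * (f x * ln (f x)) <= f x `^ (1 + s).
Proof.
move=> s0; have [fx0|fx0] := eqVneq (f x) 0.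
  by rewrite fx0 mul0r mulr0 addr0 powR0.
have fgt0 : 0 < f x by rewrite lt_neqAle eq_sym fx0 f0.
rewrite powRD ?fx0 ?implybT// powRr1// mulrCA.
rewrite -[X in X + _]mulr1 -mulrDr ler_pM2l//.
by rewrite /powR (negbTE fx0) expR_ge1Dx.
Qed.

(** The tangent inequality at [s = 1/2] and [s = -1/2] bounds [f ln f] from above and below, with
    absolute value at most [2 (f^(3/2) + f^(1/2))]. *)
Lemma integrable_density_ln :
  mu.-integrable setT (fun x => (f x * ln (f x))%:E).
Proof.
have h1 : `|2^-1 : R| <= 2^-1 by rewrite ger0_norm.
have h2 : `|- 2^-1 : R| <= 2^-1 by rewrite normrN ger0_norm.
have i1 := integrable_density_powR _ h1; have i2 := integrable_density_powR _ h2.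
apply: (le_integrable measurableT _ _
  (integrableZl measurableT 2 (integrableD measurableT i1 i2))).
  apply/measurable_EFinP; apply: measurable_funM => //.
  exact: (measurableT_comp (@measurable_ln R) mf).
move=> x _; rewrite /= lee_fin.
have p1 := powR_ge0 (f x) (1 + 2^-1); have p2 := powR_ge0 (f x) (1 - 2^-1).
have n1 : 1 + 2^-1 != 0 :> R by lra.
have n2 : 1 - 2^-1 != 0 :> R by lra.
have t1 := density_powR_tangent _ x n1; have t2 := density_powR_tangent _ x n2.
have fx0 := f0 x; rewrite [leRHS]ger0_norm; last by lra.
by rewrite ler_norml; apply/andP; split; lra.
Qed.

Lemma integral_density_ln :
  (\int[mu]_x (f x * ln (f x))%:E = (- H)%:E)%E.
Proof.
have iu := integrable_density_ln.
have := integrable_fin_num measurableT iu.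
set J := (\int[mu]_x _)%E => /fineK; rewrite /J => JE; rewrite -JE.
congr (_%:E); apply: exp_bound_slope => s sh.
have s0 : 1 + s != 0.
  by move: sh; rewrite ler_norml => /andP[+ _]; apply: contraTneq; lra.
have if1 : mu.-integrable setT (EFin \o f).
  apply/integrableP; split; first exact/measurable_EFinP.
  by under eq_integral do rewrite /= ger0_norm//; rewrite f1 ltry.
have isu := integrableZl measurableT s iu.
rewrite -lee_fin; apply: le_trans (fH _ sh).
rewrite EFinD EFinM JE -f1 -integralZl// -integralD//.
apply: le_integral => //.
- exact: integrableD.
- exact: integrable_density_powR.
- by move=> x _; rewrite /= lee_fin; exact: density_powR_tangent.
Qed.

Lemma diff_entropyE : diff_entropy f = (H / ln 2)%:E.
Proof.
have fl x : ((f x)%:E * log2 (f x) = (ln 2)^-1%:E * (f x * ln (f x))%:E)%E.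
  rewrite /log2; have [fx0|fx0] := eqVneq (f x) 0.
    by rewrite fx0 mul0r mule0 mul0e.
  rewrite lne_EFin; last by rewrite lt_neqAle eq_sym fx0 f0.
  by rewrite -!EFinM; congr (_%:E); ring.
rewrite /diff_entropy; under eq_integral do rewrite fl.
rewrite integralZl//; last exact: integrable_density_ln.
by rewrite integral_density_ln -EFinM -EFinN mulrN opprK mulrC.
Qed.

(** * Volume bounds for the typical set *)

Lemma typical_setE (eps : R) n : (0 < n)%N ->
  typical_set f eps n =
  (fun t : n.-tuple R => joint_density f t) @^-1`
    `[expR (- (n%:R * (H + eps * ln 2))), expR (- (n%:R * (H - eps * ln 2)))].
Proof.
move=> n0; have N0 : 0 < n%:R :> R by rewrite ltr0n.
have l2 : 0 < ln 2 :> R by rewrite ln_gt0// ltr1n.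
apply/seteqP; rewrite /typical_set diff_entropyE.
suff E (t : n.-tuple R) :
  (`|- ((n%:R^-1)%:E * log2 (joint_density f t)) - (H / ln 2)%:E| <= eps%:E)%E
  = (joint_density f t \in
    `[expR (- (n%:R * (H + eps * ln 2))), expR (- (n%:R * (H - eps * ln 2)))]).
  by split=> t /=; rewrite E.
(* Where the joint density vanishes, its logarithm is [-oo] and the deviation [+oo], so the point
   lies in neither set. *)
have [J0|J0] := eqVneq (joint_density f t) 0.
  rewrite J0 in_itv/= (lt_geF (expR_gt0 _))/= /log2 le0_lneNy//.
  by rewrite gt0_mulNye ?lte_fin ?invr_gt0// gt0_muleNy ?lte_fin ?invr_gt0//.
have {}J0 : 0 < joint_density f t by rewrite lt_neqAle eq_sym J0 joint_density_ge0.
rewrite /log2 lne_EFin// -!EFinM -!EFinN -EFinD abse_EFin lee_fin.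
rewrite in_itv/= -{2 3}(@lnK _ (joint_density f t)) ?posrE// !ler_expR.
set L := ln _; rewrite ler_norml.
have -> : - (n%:R^-1 * (L / ln 2)) - H / ln 2 = (- L - n%:R * H) / (n%:R * ln 2).
  by field; rewrite !gt_eqF.
rewrite ler_pdivlMr ?mulr_gt0// ler_pdivrMr ?mulr_gt0// andbC.
by congr (_ && _); apply/idP/idP; lra.
Qed.


Lemma measurable_typical_set (eps : R) n : (0 < n)%N ->
  measurable (typical_set f eps n : set (n.-tuple (measurableTypeR R))).
Proof.
move=> n0; rewrite typical_setE// -[X in measurable X]setTI.
by apply: measurable_joint_density => //; exact: measurable_itv.
Qed.

Lemma Vol_typical_set_le (eps : R) n : (0 < n)%N ->
  (Vol (typical_set f eps n) <= (expR (n%:R * (H + eps * ln 2)))%:E)%E.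
Proof.
move=> n0; have mA := measurable_typical_set eps n n0.
set y := n%:R * _.
(* Markov's inequality: [exp (- y)] times the indicator of the typical set is below the joint
   density, whose integral is 1. *)
suff : ((expR (- y))%:E * Vol (typical_set f eps n) <= 1)%E.
  rewrite muleC -lee_pdivlMr ?expR_gt0// => /le_trans; apply.
  by rewrite mul1e -expRN opprK.
have <- : (\int[@Vol R n]_t (joint_density f t)%:E = 1)%E.
  by rewrite (integral_joint_density _ _ 1)// expr1n.
rewrite -[X in (_ * Vol X)%E]setIT -integral_indic// -ge0_integralZl//;
  last exact/measurable_EFinP.
apply: ge0_le_integral => //.
- by apply/measurable_EFinP; apply: measurable_funM.
- by apply/measurable_EFinP; exact: measurable_joint_density.
move=> t _; rewrite -EFinM lee_fin indicE.
have [|_] := boolP (t \in _); last by rewrite mulr0 joint_density_ge0.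
by rewrite inE typical_setE//= in_itv/= mulr1 => /andP[].
Qed.

(** Pointwise Chernoff bound, with one nonnegative term per case: if [J < exp (- a)], then
    [J^s <= exp (- s a)]; if [J > exp (- b)], then [J^(- s) <= exp (s b)]; otherwise [t] is typical
    and [J <= exp (- b)]. *)
Lemma joint_density_le (eps s : R) n (t : n.-tuple R) : (0 < n)%N -> 0 <= s ->
  joint_density f t <=
    expR (- (n%:R * (H - eps * ln 2))) * \1_(typical_set f eps n) t
    + expR (- (s * (n%:R * (H + eps * ln 2)))) * joint_density f t `^ (1 - s)
    + expR (s * (n%:R * (H - eps * ln 2))) * joint_density f t `^ (1 + s).
Proof.
move=> n0 s0; set a := n%:R * (H + eps * ln 2); set b := n%:R * (H - eps * ln 2).
have J0 := joint_density_ge0 _ _ _ t f0; set J := joint_density f t in J0 *.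
have e1 := mulr_ge0 (expR_ge0 (- (s * a))) (powR_ge0 J (1 - s)).
have e2 := mulr_ge0 (expR_ge0 (s * b)) (powR_ge0 J (1 + s)).
have e3 : 0 <= expR (- b) * \1_(typical_set f eps n) t.
  by rewrite mulr_ge0 ?expR_ge0.
have [Jz|Jz] := eqVneq J 0; first by rewrite {1}Jz; lra.
have {}J0 : 0 < J by rewrite lt_neqAle eq_sym Jz.
have JL : J = expR (ln J) by rewrite lnK.
have [Ja|Ja] := ltP J (expR (- a)).
  suff : J <= expR (- (s * a)) * J `^ (1 - s) by lra.
  rewrite /powR (negbTE Jz) -expRD [leLHS]JL ler_expR.
  by move: Ja; rewrite [X in X < _]JL ltr_expR; nra.
have [Jb|Jb] := ltP (expR (- b)) J.
  suff : J <= expR (s * b) * J `^ (1 + s) by lra.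
  rewrite /powR (negbTE Jz) -expRD [leLHS]JL ler_expR.
  by move: Jb; rewrite [X in _ < X]JL ltr_expR; nra.
suff : t \in typical_set f eps n by rewrite indicE => -> /=; lra.
by rewrite inE typical_setE//= in_itv/= Ja Jb.
Qed.

Lemma integral_joint_density_powR (s : R) n : `|s| <= 2^-1 ->
  (\int[@Vol R n]_t (joint_density f t `^ (1 + s))%:E
    <= (expR (n%:R * (s ^+ 2 - s * H)))%:E)%E.
Proof.
move=> sh; have fs0 x : 0 <= f x `^ (1 + s) by exact: powR_ge0.
have Kfin := integrable_fin_num measurableT (integrable_density_powR _ sh).
have K0 : 0 <= fine (\int[mu]_x (f x `^ (1 + s))%:E)%E.
  by rewrite fine_ge0// integral_ge0// => x _; rewrite lee_fin.
under eq_integral do rewrite -joint_density_powR//.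
rewrite (integral_joint_density _ _ (fine (\int[mu]_x (f x `^ (1 + s))%:E)%E))//;
  last 2 first.
- exact: (measurableT_comp (measurable_powR (1 + s)) mf).
- by rewrite fineK.
rewrite lee_fin expRM_natl lerXn2r ?nnegrE ?expR_ge0//.
by rewrite -lee_fin fineK// fH.
Qed.

(** Integrating the pointwise bound gives [1 <= exp (- b) Vol + 2 q]: in both tail terms [H] cancels
    from the exponent, leaving [n (s^2 - s eps ln 2)]. *)
Lemma Vol_typical_set_ge (eps s : R) n : (0 < n)%N -> 0 <= s <= 2^-1 ->
  (((1 - 2 * expR (n%:R * (s ^+ 2 - s * (eps * ln 2)))) *
     expR (n%:R * (H - eps * ln 2)))%:E <= Vol (typical_set f eps n))%E.
Proof.
move=> n0 /andP[s0 s1]; have mA := measurable_typical_set eps n n0.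
set q := expR (n%:R * (s ^+ 2 - _)); set b := n%:R * (H - _).
rewrite EFinM -[expR b]invrK -expRN lee_pdivrMr ?expR_gt0// muleC.
rewrite EFinB leeBlDr//.
pose J := @joint_density R f n.
have mJ p : measurable_fun setT (fun t : n.-tuple (measurableTypeR R) => J t `^ p).
  apply: (measurableT_comp (measurable_powR p)).
  exact: measurable_joint_density.
have <- : (\int[@Vol R n]_t (J t)%:E = 1)%E.
  by rewrite (integral_joint_density _ _ 1)// expr1n.
pose a := n%:R * (H + eps * ln 2).
pose g1 (t : n.-tuple (measurableTypeR R)) :=
  ((expR (- b))%:E * (\1_(typical_set f eps n) t)%:E)%E.
pose g2 (t : n.-tuple (measurableTypeR R)) :=
  ((expR (- (s * a)))%:E * (J t `^ (1 - s))%:E)%E.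
pose g3 (t : n.-tuple (measurableTypeR R)) :=
  ((expR (s * b))%:E * (J t `^ (1 + s))%:E)%E.
have g10 t : (0 <= g1 t)%E by rewrite mule_ge0 ?lee_fin ?expR_ge0.
have g20 t : (0 <= g2 t)%E by rewrite mule_ge0 ?lee_fin ?expR_ge0 ?powR_ge0.
have g30 t : (0 <= g3 t)%E by rewrite mule_ge0 ?lee_fin ?expR_ge0 ?powR_ge0.
have mg1 : measurable_fun setT g1.
  by apply/measurable_EFinP; apply: measurable_funM.
have mg2 : measurable_fun setT g2.
  by apply/measurable_EFinP; apply: measurable_funM.
have mg3 : measurable_fun setT g3.
  by apply/measurable_EFinP; apply: measurable_funM.
apply: (@le_trans _ _ (\int[@Vol R n]_t (g1 t + g2 t + g3 t)%E)%E).
  apply: ge0_le_integral => //.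
  - by move=> t _; rewrite lee_fin joint_density_ge0.
  - by apply/measurable_EFinP; exact: measurable_joint_density.
  - by do 2 apply: emeasurable_funD => //.
  - move=> t _; rewrite /g1 /g2 /g3 -!EFinM -!EFinD lee_fin.
    exact: joint_density_le.
rewrite ge0_integralD//; last 2 first.
- by move=> t _; rewrite adde_ge0.
- exact: emeasurable_funD.
rewrite ge0_integralD// -addeA leeD//.
  rewrite ge0_integralZl//; last exact/measurable_EFinP.
  by rewrite integral_indic// setIT.
have h1 : `|s| <= 2^-1 by rewrite ger0_norm.
have h2 : `|- s| <= 2^-1 by rewrite normrN.
have -> : 2 * q = q + q by ring.
rewrite EFinD leeD//.
- rewrite ge0_integralZl//; last 2 first.
  - exact/measurable_EFinP.
  - by move=> t _; rewrite lee_fin powR_ge0.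
  apply: (@le_trans _ _ ((expR (- (s * a)))%:E *
      (expR (n%:R * ((- s) ^+ 2 - (- s) * H)))%:E)%E).
    by apply: lee_wpmul2l => //; exact: integral_joint_density_powR.
  rewrite -EFinM lee_fin -expRD ler_expR le_eqVlt; apply/orP; left; apply/eqP.
  by rewrite /a; ring.
- rewrite ge0_integralZl//; last 2 first.
  - exact/measurable_EFinP.
  - by move=> t _; rewrite lee_fin powR_ge0.
  apply: (@le_trans _ _ ((expR (s * b))%:E *
      (expR (n%:R * (s ^+ 2 - s * H)))%:E)%E).
    by apply: lee_wpmul2l => //; exact: integral_joint_density_powR.
  rewrite -EFinM lee_fin -expRD ler_expR le_eqVlt; apply/orP; left; apply/eqP.
  by rewrite /b; ring.
Qed.

Lemma near_Vol_typical_set_ge (eps : R) : 0 < eps ->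
  \forall n \near \oo, (((1 - eps) * expR (n%:R * (H - eps * ln 2)))%:E
    <= Vol (typical_set f eps n))%E.
Proof.
move=> eps0; have l2 : 0 < ln 2 :> R by rewrite ln_gt0// ltr1n.
have d0 : 0 < eps * ln 2 by exact: mulr_gt0.
(* The first bound keeps [s] in the range of the moment estimate; the second makes
   [s^2 - s eps ln 2] negative, so that [r < 1]. *)
pose s := Num.min 2^-1 (eps * ln 2 / 2).
have s0 : 0 < s by rewrite lt_min divr_gt0// invr_gt0 ltr0n.
have s1 : s <= 2^-1 by rewrite ge_min lexx.
have s2 : s <= eps * ln 2 / 2 by rewrite ge_min lexx orbT.
pose r := expR (s ^+ 2 - s * (eps * ln 2)).
have r1 : `|r| < 1 by rewrite gtr0_norm ?expR_gt0// expR_lt1; nra.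
(* Once [r^n <= eps / 2], the factor [1 - 2 r^n] is at least [1 - eps]. *)
have /cvgrPdist_le/(_ (eps / 2)) := cvg_expr r1.
rewrite divr_gt0// => /(_ isT) rn; near=> n.
have n0 : (0 < n)%N by near: n; exact: nbhs_infty_gt.
apply: le_trans (Vol_typical_set_ge eps s n n0 _); last by rewrite (ltW s0).
rewrite lee_fin ler_pM2r ?expR_gt0// lerD2l lerN2 expRM_natl -/r.
have : `|0 - r ^+ n| <= eps / 2 by near: n.
rewrite sub0r normrN ger0_norm ?exprn_ge0 ?expR_ge0//; lra.
Unshelve. all: by end_near. Qed.

End concentration.

(** * Typical sets of a Gaussian variable *)

Theorem proposition3p14 (R : realType) (d : measure_display)
    (T : measurableType d) (P : probability T R) (X : {RV P >-> R})
    (f : R -> R) (sigma : R) (sigma_gt0 : 0 < sigma)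
    (XN : forall A : set R, measurable A ->
       distribution P X A = normal_prob 0 sigma A)
    (Xf : is_density X f) (eps : R) (eps_gt0 : 0 < eps) :
  \forall n \near \oo,
    (((1 - eps) * (2 `^ (- eps) * Num.sqrt (2 * pi * expR 1) * sigma) ^+ n)%:E
      <= Vol (typical_set f eps n))%E /\
    (Vol (typical_set f eps n) <=
      ((2 `^ eps * Num.sqrt (2 * pi * expR 1) * sigma) ^+ n)%:E)%E.
Proof.
have gf := density_ae_normal_pdf R d T P X f 0 sigma XN Xf.
have [mf f0 fX] := Xf.
pose H := ln (Num.sqrt (2 * pi * expR 1) * sigma).
have fH : power_moment_bound f H.
  apply: (ae_eq_power_moment_bound _ _ _ _ _ mf gf).
    exact: measurable_normal_pdf.
  exact: normal_pdf_power_moment_bound.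
have f1 : (\int[lebesgue_measure]_x (f x)%:E = 1)%E.
  by rewrite -(fX setT measurableT) probability_setT.
(* Used at [r = - eps] and [r = eps] to put both bounds in exponential form. *)
have E (r : R) n : (2 `^ r * Num.sqrt (2 * pi * expR 1) * sigma) ^+ n =
    expR (n%:R * (H + r * ln 2)).
  rewrite expRM_natl addrC expRD lnK; last first.
    by rewrite posrE !mulr_gt0 ?sqrtr_gt0 ?mulr_gt0 ?expR_gt0 ?pi_gt0.
  by rewrite /powR pnatr_eq0/= mulrA.
near=> n; rewrite !E mulNr; split.
  by near: n; exact: near_Vol_typical_set_ge.
apply: Vol_typical_set_le => //.
by near: n; exact: nbhs_infty_gt.
Unshelve. all: by end_near. Qed.
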